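(* Let $R$ be a semiprime ring with (left) Krull dimension and let $\sigma$ be a ring endomorphism of $R$ with large image. Then $\sigma$ is a monomorphism.
   Context: Rings are associative and unital, and ring endomorphisms preserve $1$. ''Module'' means left module. A monomorphism is an injective ring homomorphism. Krull dimension is the Gabriel–Rentschler (possibly transfinite, ordinal-valued) Krull dimension, i.e. the deviation of the lattice of submodules; a ring $R$ has Krull dimension if the left module ${}_RR$ has Krull dimension. A left ideal of a ring is essential if it has nonzero intersection with every nonzero left ideal of the ring. An endomorphism $\sigma$ of $R$ has large image if $\sigma(R)$ contains an essential left ideal of $R$. *)

(* Defs.v *)
From HB Require Import structures.
From mathcomp Require Import all_boot all_order all_algebra.
From mathcomp Require Import boolp classical_sets.

Set Implicit Arguments.
Unset Strict Implicit.
Unset Printing Implicit Defensive.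

Import Order.TTheory GRing.Theory.
Local Open Scope classical_set_scope.
Local Open Scope ring_scope.

(* Ordinals as well-founded trees: [Olub A f] is the least ordinal strictly above
   all the [f i], so zero is [Olub] over the empty type.  Distinct trees may
   denote the same ordinal; only the comparisons below are meaningful. *)
Inductive ordi : Type := Olub (A : Type) (f : A -> ordi).
Arguments Olub : clear implicits.

Fixpoint ordi_le (a b : ordi) : Prop :=
  match a, b with
  | Olub A f, Olub B g => forall i : A, exists j : B, ordi_le (f i) (g j)
  end.

Definition ordi_lt (a b : ordi) : Prop :=
  match b with Olub B g => exists j : B, ordi_le a (g j) end.

Definition trivial_poset d (T : porderType d) (P : set T) : Prop :=
  forall x y : T, P x -> P y -> (x <= y)%O -> x = y.

Definition factor d (T : porderType d) (P : set T) (b a : T) : set T :=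
  [set x | P x /\ (b <= x <= a)%O].

(* [dev_le a P]: the deviation of the subposet [P] of [T] is at most [a], i.e.
   in every descending chain of [P] all but finitely many factors have
   deviation < [a].  For [a = Olub A f], having deviation < [a] means being
   trivial (deviation -oo) or having deviation at most some [f i]. *)
Fixpoint dev_le d (T : porderType d) (a : ordi) (P : set T) : Prop :=
  match a with Olub A f =>
  forall c : nat -> T, (forall k, P (c k)) -> (forall k, (c k.+1 <= c k)%O) ->
  exists n : nat, forall k : nat, (n <= k)%N ->
    trivial_poset (factor P (c k.+1) (c k)) \/
    exists i : A, dev_le (f i) (factor P (c k.+1) (c k))
  end.

(* [None] stands for the value -oo (also written -1) of trivial posets. *)
Definition deviation d (T : porderType d) (P : set T) (v : option ordi) : Prop :=
  if v is Some a then
    [/\ ~ trivial_poset P, dev_le a P & forall b, ordi_lt b a -> ~ dev_le b P]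
  else trivial_poset P.

Definition submodule (R : pzRingType) (M : lmodType R) (N : set M) : Prop :=
  submod_closed [in N].

(* [set M] is ordered by inclusion ([subsetEset]). *)
Definition Krull_dim (R : pzRingType) (M : lmodType R) (v : option ordi) : Prop :=
  deviation [set N : set M | submodule N] v.

Definition has_Krull_dim (R : pzRingType) (M : lmodType R) : Prop :=
  exists v : option ordi, Krull_dim M v.

Definition left_ideal (R : pzRingType) (L : set R) : Prop :=
  @submodule R R^o L.

Definition ideal (R : pzRingType) (J : set R) : Prop :=
  left_ideal J /\ forall x r : R, J x -> J (x * r).

(* [J ^ n = 0]: the ideal [J ^ n] is additively generated by these products. *)
Definition nilpotent_ideal (R : pzRingType) (J : set R) : Prop :=
  exists n : nat, forall x : 'I_n -> R,
    (forall i, J (x i)) -> \prod_(i < n) x i = 0.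

Definition semiprime_ring (R : pzRingType) : Prop :=
  forall J : set R, ideal J -> nilpotent_ideal J -> J = [set 0].

Definition essential_left_ideal (R : pzRingType) (E : set R) : Prop :=
  left_ideal E /\
  forall L : set R, left_ideal L -> L <> [set 0] -> E `&` L <> [set 0].

Definition large_image (R : pzRingType) (sigma : R -> R) : Prop :=
  exists E : set R, essential_left_ideal E /\ E `<=` range sigma.

Lemma ordi_le_refl a : ordi_le a a.
Proof. by elim: a => I f IH /= i; exists i. Qed.

Lemma ordi_le_trans a b c : ordi_le a b -> ordi_le b c -> ordi_le a c.
Proof.
elim: a b c => I f IH [J g] [K h] /= ab bc i.
by have [j ij] := ab i; have [k jk] := bc j; exists k; apply: IH jk.
Qed.

Lemma ordi_lt_wf : well_founded ordi_lt.
Proof.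
suff H a : forall b, ordi_le b a -> Acc ordi_lt b.
  by move=> a; apply: (H a); exact: ordi_le_refl.
elim: a => I f IH [J g] /= ba; constructor=> c /= [j cj].
by have [i ji] := ba j; apply: (IH i); apply: ordi_le_trans ji.
Qed.

Lemma deviation_exP d (T : porderType d) (P : set T) :
  (exists v, deviation P v) <-> exists a, dev_le a P.
Proof.
split=> [[[a [_ aP _]|trivP]]|[a]].
- by exists a.
- exists (Olub False (fun x => match x with end)) => /= c Pc dc.
  exists 0%N => k _; left=> x y [Px _] [Py _]; exact: trivP.
elim/(well_founded_ind ordi_lt_wf): a => a IH aP.
have [trivP|ntP] := pselect (trivial_poset P); first by exists None.
have [[b ba bP]|nb] := pselect (exists2 b, ordi_lt b a & dev_le b P).
  exact: IH bP.
by exists (Some a); split=> // b ba bP; apply: nb; exists b.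
Qed.

(* No bound on the deviations of the factors is needed for the deviation of
   [P] to exist; in particular there are enough ordinals in [ordi]. *)
Lemma dev_le_chain d (T : porderType d) (P : set T) :
  (forall c : nat -> T, (forall k, P (c k)) -> (forall k, (c k.+1 <= c k)%O) ->
   exists n : nat, forall k : nat, (n <= k)%N ->
     exists v, deviation (factor P (c k.+1) (c k)) v) ->
  exists a, dev_le a P.
Proof.
move=> H.
have /choice[f fP] (p : T * T) : exists a, (exists a, dev_le a (factor P p.1 p.2))
    -> dev_le a (factor P p.1 p.2).
  have [[a ?]|nex] := pselect (exists a, dev_le a (factor P p.1 p.2)).
    by exists a.
  by exists (Olub False (fun x => match x with end)) => /nex.
exists (Olub _ f) => /= c Pc dc; have [n Hn] := H c Pc dc.
exists n => k /Hn/deviation_exP ex; right; exists (c k.+1, c k).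
exact: (fP (c k.+1, c k)).
Qed.

(* Main.v *)
(* Write [S] for the image of [sigma] and [E] for an essential left ideal of [R]
   inside [S]. The ring [R] has finitely many minimal primes [P_i], with zero
   intersection; they are annihilators of critical left ideals. Each
   [P'_i = sigma^-1 P_i] is prime, hence contains some [P_(t i)]. As [R / P'_i] is
   isomorphic to [S / (P_i :&: S)], whose left ideals include a copy of those of
   [R / P_i],
     kdim R/P_i <= kdim R/P'_i <= kdim R/P_(t i),
   and the second inequality is strict unless [P'_i = P_(t i)]. So equality holds
   when [i] is periodic under [t]. Moreover [P'_i `<=` P'_j] forces
   [P_i `<=` P_j], hence [P_i = P_j]; it follows by backward induction along [t]
   that every [P_i] is some [P'_j]. The kernel of [sigma] is contained in all the
   [P'_j], hence in the intersection of the [P_i], which is zero. *)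
Require Import Defs.
From mathcomp Require Import all_boot all_order all_algebra.
From mathcomp Require Import boolp classical_sets.
Local Open Scope ring_scope.

Set Implicit Arguments.
Unset Strict Implicit.
Unset Printing Implicit Defensive.

Import Order.TTheory GRing.Theory.
Local Open Scope classical_set_scope.

(** * Deviation of posets *)

(** Induction on the ordinal, as [phi] maps factors of [P] into factors of [Q]. Injectivity on
    comparable pairs suffices, since triviality of a factor concerns only these. *)
Lemma dev_le_embed d d' (T : porderType d) (T' : porderType d') (phi : T -> T')
    a (P : set T) (Q : set T') :
  (forall x, P x -> Q (phi x)) ->
  (forall x y, P x -> P y -> (x <= y)%O -> (phi x <= phi y)%O) ->
  (forall x y, P x -> P y -> (x <= y)%O -> phi x = phi y -> x = y) ->
  dev_le a Q -> dev_le a P.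
Proof.
elim: a P Q => A f IH P Q PQ mono inj /= devQ c Pc dc.
have [|n nP] := devQ (phi \o c) (fun k => PQ _ (Pc k)).
  by move=> k; apply: mono.
have factorPQ k x : factor P (c k.+1) (c k) x ->
    factor Q (phi (c k.+1)) (phi (c k)) (phi x).
  move=> [Px /andP[lex xle]]; split; first exact: PQ.
  by apply/andP; split; apply: mono.
exists n => k /nP[triv|[i devi]].
- left=> x y fx fy lexy; apply: inj => //; [exact: fx.1|exact: fy.1|].
  apply: triv; [exact: factorPQ|exact: factorPQ|].
  by apply: mono => //; [exact: fx.1|exact: fy.1].
right; exists i; apply: IH devi.
- exact: factorPQ.
- by move=> x y [Px _] [Py _]; apply: mono.
- by move=> x y [Px _] [Py _]; apply: inj.
Qed.

Lemma dev_le_min d (T : porderType d) (I : Type) (P : I -> set T) (i : I) a :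
  dev_le a (P i) ->
  exists b j, dev_le b (P j) /\ forall b' j', ordi_lt b' b -> ~ dev_le b' (P j').
Proof.
elim/(well_founded_ind ordi_lt_wf): a i => a IH i aP.
have [[b [j [ba bP]]]|nb] :=
  pselect (exists b j, ordi_lt b a /\ dev_le b (P j)); first exact: IH bP.
by exists a, i; split=> // b j ba bP; apply: nb; exists b, j.
Qed.

Lemma ordi_lt_Olub A f i : ordi_lt (f i) (Olub A f).
Proof. by exists i; exact: ordi_le_refl. Qed.

Lemma factorI T (P : set (set T)) (b a x : set T) :
  P x -> b `<=` x -> x `<=` a -> factor P b a x.
Proof. by move=> Px bx xa; split=> //; apply/andP; split; rewrite subsetEset. Qed.

(* Between the sets of multiples of [2 ^ k.+1] and of [2 ^ k] one finds a copy of
   the whole power set, namely the sets of odd multiples of [2 ^ k]. *)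
Lemma powerset_nat_no_dev a : ~ dev_le a [set: set nat].
Proof.
elim: a => A f IH /=.
move=> /(_ (fun k => [set m | 2 ^ k %| m]%N) (fun=> I)).
have dvdS k m : (2 ^ k.+1 %| m -> 2 ^ k %| m)%N.
  by apply: dvdn_trans; rewrite expnS dvdn_mull.
case=> [k|n /(_ n (leqnn n)) H]; first by rewrite subsetEset => m /dvdS.
pose phi (X : set nat) : set nat :=
  [set m | (2 ^ n.+1 %| m)%N \/ exists2 x, X x & m = (2 ^ n * x.*2.+1)%N].
have phiP X : factor [set: set nat] [set m | (2 ^ n.+1 %| m)%N]
    [set m | (2 ^ n %| m)%N] (phi X).
  apply: factorI => //; first by move=> m; left.
  by move=> m [/dvdS//|[x _ ->]]; rewrite /= dvdn_mulr.
have phi_mono X Y : X `<=` Y -> phi X `<=` phi Y.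
  by move=> XY m [?|[x /XY Yx ->]]; [left|right; exists x].
have phi_inj X Y : phi X = phi Y -> X `<=` Y.
  move=> eXY x Xx; have : phi X (2 ^ n * x.*2.+1)%N by right; exists x.
  rewrite eXY => -[|[y Yy /eqP]].
    by rewrite /= expnSr dvdn_pmul2l ?expn_gt0// dvdn2 /= odd_double.
  by rewrite eqn_pmul2l ?expn_gt0// eqSS -!mul2n eqn_pmul2l// => /eqP ->.
case: H => [triv|[i devi]].
  have : phi set0 = phi setT.
    by apply: triv => //; rewrite subsetEset; exact: phi_mono.
  by move/esym/phi_inj => /(_ 0%N I).
apply: (IH i); apply: dev_le_embed devi => //.
- by move=> X Y _ _; rewrite !subsetEset; exact: phi_mono.
- by move=> X Y _ _ _ e; apply/seteqP; split; apply: phi_inj.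
Qed.

(** * Left ideals and their multiples [L c + P] *)

Section LeftIdeals.
Context {R : pzRingType}.
Implicit Types (P L E U V W N : set R).

Lemma left_idealP L : left_ideal L <->
  [/\ L 0, forall x y, L x -> L y -> L (x + y) & forall r x, L x -> L (r * x)].
Proof.
rewrite /left_ideal /submodule; split=> [[L0 Llin]|[L0 LD LM]].
  have {}L0 : L 0 by move: L0; rewrite inE.
  have {}Llin r x y : L x -> L y -> L (r * x + y).
    move=> Lx Ly; have := Llin r x y; rewrite !inE; exact.
  split=> // [x y Lx Ly|r x Lx]; first by rewrite -[x]mul1r; exact: Llin.
  by rewrite -[_ * _]addr0; exact: Llin.
split; first by rewrite inE.
by move=> r x y; rewrite !inE => Lx Ly; apply: LD => //; apply: LM.
Qed.

Lemma left_ideal0 L : left_ideal L -> L 0.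
Proof. by case/left_idealP. Qed.

Lemma left_idealD L x y : left_ideal L -> L x -> L y -> L (x + y).
Proof. by case/left_idealP => _ + _; apply. Qed.

Lemma left_idealM L r x : left_ideal L -> L x -> L (r * x).
Proof. by case/left_idealP => _ _; apply. Qed.

Lemma left_idealN L x : left_ideal L -> L x -> L (- x).
Proof. by move=> iL Lx; rewrite -mulN1r; exact: left_idealM. Qed.

Lemma left_idealBr L x y : left_ideal L -> L y -> L (x - y) -> L x.
Proof. by move=> iL Ly Lxy; rewrite -(subrK y x); exact: left_idealD. Qed.

Lemma left_ideal_sum L n (F : 'I_n -> R) :
  left_ideal L -> (forall i, L (F i)) -> L (\sum_i F i).
Proof.
move=> iL LF; apply: (big_ind L) => //; first exact: left_ideal0.
by move=> x y; exact: left_idealD.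
Qed.

Lemma left_ideal_setT : left_ideal [set: R].
Proof. exact/left_idealP. Qed.

Lemma left_ideal_setI L N : left_ideal L -> left_ideal N -> left_ideal (L `&` N).
Proof.
move=> iL iN; apply/left_idealP; split.
- by split; exact: left_ideal0.
- by move=> x y [Lx Nx] [Ly Ny]; split; exact: left_idealD.
- by move=> r x [Lx Nx]; split; exact: left_idealM.
Qed.

Lemma left_ideal_colon L y : left_ideal L -> left_ideal [set x | L (x * y)].
Proof.
move=> iL; apply/left_idealP; split=> /=.
- by rewrite mul0r; exact: left_ideal0.
- by move=> x z Lx Lz; rewrite mulrDl; exact: left_idealD.
- by move=> r x Lx; rewrite -mulrA; exact: left_idealM.
Qed.

(** Plays the role of [L c] in [R / P]: no quotient is formed, left ideals above [P] stand for those
    of the quotient. *)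
Definition mulD L c P : set R := [set x | exists l p, [/\ L l, P p & x = l * c + p]].

Lemma left_ideal_mulD L c P :
  left_ideal L -> left_ideal P -> left_ideal (mulD L c P).
Proof.
move=> iL iP; apply/left_idealP; split.
- exists 0, 0; split; [exact: left_ideal0|exact: left_ideal0|].
  by rewrite mul0r addr0.
- move=> _ _ [l [p [Ll Pp ->]]] [m [q [Lm Pq ->]]].
  exists (l + m), (p + q); split; [exact: left_idealD|exact: left_idealD|].
  by rewrite mulrDl addrACA.
- move=> r _ [l [p [Ll Pp ->]]]; exists (r * l), (r * p).
  by split; [exact: left_idealM|exact: left_idealM|rewrite mulrDr mulrA].
Qed.

Lemma mulDr L c P p : left_ideal L -> P p -> mulD L c P p.
Proof.
by move=> iL Pp; exists 0, p; split; [exact: left_ideal0| |rewrite mul0r add0r].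
Qed.

Lemma mulDl L c P l : left_ideal P -> L l -> mulD L c P (l * c).
Proof. by move=> iP Ll; exists l, 0; split; [|exact: left_ideal0|rewrite addr0]. Qed.

Lemma mulDS L N c P : L `<=` N -> mulD L c P `<=` mulD N c P.
Proof. by move=> LN x [l [p [Ll Pp ->]]]; exists l, p; split; first exact: LN. Qed.

Definition lregular P c := forall x, P (x * c) -> P x.

Lemma mulD_lregular L c P x : left_ideal L -> P `<=` L -> lregular P c ->
  mulD L c P (x * c) -> L x.
Proof.
move=> iL PL reg_c [l [p [Ll Pp e]]]; apply: (left_idealBr iL Ll).
by apply/PL/reg_c; rewrite mulrBl e addrC addKr.
Qed.

(** For left ideals [P] inside [L], this is the submodule lattice of [L / P]. *)
Definition between P L : set (set R) :=
  [set N | left_ideal N /\ P `<=` N /\ N `<=` L].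

Lemma dev_le_betweenS P L P' L' a : P' `<=` P -> L `<=` L' ->
  dev_le a (between P' L') -> dev_le a (between P L).
Proof.
move=> PP LL; apply: (@dev_le_embed _ _ _ _ id) => // N [iN [PN NL]].
by split=> //; split; [exact: subset_trans PN|exact: subset_trans LL].
Qed.

Lemma factor_between P L V W N :
  left_ideal N -> P `<=` W -> V `<=` L -> W `<=` N -> N `<=` V ->
  factor (between P L) W V N.
Proof.
move=> iN PW VL WN NV; apply: factorI => //.
by split=> //; split; [exact: subset_trans WN|exact: subset_trans VL].
Qed.

Lemma idealMr P x r : ideal P -> P x -> P (x * r).
Proof. by case=> _; apply. Qed.

(** * Semiprimeness, essentiality and critical left ideals modulo [P] *)

Definition semiprime P := forall x, (forall r, P (x * r * x)) -> P x.

(** The multiple lies in [E] itself, not merely in [E + P]; this later places it in the image of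
    [sigma]. *)
Definition essential P E :=
  forall x, ~ P x -> exists r, E (r * x) /\ ~ P (r * x).

Definition has_dev P := exists a, dev_le a (between P setT).

(* The only property of critical submodules of the ring modulo [P] that matters:
   right multiplication by an element of [U] is zero or injective on [U]. *)
Definition critical P U := [/\ left_ideal U, P `<=` U, exists u, U u /\ ~ P u &
  forall u, U u -> (exists x, U x /\ ~ P (x * u)) ->
    forall x, U x -> P (x * u) -> P x].

(* Take [U] of least deviation inside [L]. If no left ideal below [U] is
   critical, the kernels of multiplications yield a descending chain with factors
   isomorphic to nonzero left ideals, hence of deviation at least that of [U]. *)
Lemma critical_exists P L : ideal P -> has_dev P ->
  left_ideal L -> P `<=` L -> (exists x, L x /\ ~ P x) ->
  exists U, critical P U /\ U `<=` L.
Proof.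
move=> idP [a0 dev0] iL PL ntL; have iP := idP.1.
pose sub := {V : set R | [/\ left_ideal V, P `<=` V, V `<=` L &
                          exists x, V x /\ ~ P x]}.
have subL : [/\ left_ideal L, P `<=` L, L `<=` L & exists x, L x /\ ~ P x] by split.
have [[A f] [[U [iU PU UL ntU]] [/= devU minU]]] :=
  @dev_le_min _ _ sub (fun V : sub => between P (sval V)) (exist _ L subL) a0
    (dev_le_betweenS (@subset_refl _ _) (@subsetT _ _) dev0).
apply: contrapT => nocrit.
have step (V : sub) : exists W : sub, [/\ sval W `<=` sval V,
   (exists x, sval V x /\ ~ sval W x) &
   forall i, ~ dev_le (f i) (between (sval W) (sval V))].
  case: V => V [/= iV PV VL ntV].
  have : ~ critical P V by move=> cV; apply: nocrit; exists V.
  rewrite /critical => nc.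
  have [u [Vu [x0 [Vx0 nx0]] [x [Vx [xu nPx]]]]] :
    exists u, [/\ V u, exists x, V x /\ ~ P (x * u) &
      exists x, V x /\ P (x * u) /\ ~ P x].
    apply: contrapT => nu; apply: nc; split=> // u Vu ex x Vx xu.
    by apply: contrapT => nPx; apply: nu; exists u; split=> //; exists x.
  pose W := V `&` [set x | P (x * u)].
  have subW : [/\ left_ideal W, P `<=` W, W `<=` L & exists x, W x /\ ~ P x].
    split; last by exists x.
    - by apply: left_ideal_setI => //; exact: left_ideal_colon.
    - by move=> p Pp; split; [exact: PV|exact: idealMr].
    - by move=> z [/VL].
  exists (exist _ W subW); split=> /=; first by move=> z [].
    by exists x0; split=> // -[].
  move=> i devi.
  have subVu : [/\ left_ideal (mulD V u P), P `<=` mulD V u P,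
      mulD V u P `<=` L & exists x, mulD V u P x /\ ~ P x].
    split.
    - exact: left_ideal_mulD.
    - by move=> p; exact: mulDr.
    - move=> _ [l [p [Vl Pp ->]]]; apply: left_idealD => //; last exact: PL.
      by apply: left_idealM => //; exact: VL.
    - by exists (x0 * u); split=> //; exact: mulDl.
  apply: (minU (f i) (exist _ _ subVu) (ordi_lt_Olub f i)) => /=.
  apply: (@dev_le_embed _ _ _ _ (fun N => V `&` [set x | N (x * u)])) devi.
  - move=> N [iN [PN NV]]; split.
      by apply: left_ideal_setI => //; exact: left_ideal_colon.
    by split=> [z [Vz Pz]|z []//]; split=> //; exact: PN.
  - by move=> N N' _ _; rewrite !subsetEset => NN z [Vz Nz]; split=> //; exact: NN.
  - move=> N N' [iN [PN NV]] [iN' [PN' NV']]; rewrite subsetEset => NN e.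
    apply/seteqP; split=> // z N'z; have [v [p [Vv Pp ez]]] := NV' _ N'z.
    have : (V `&` [set x | N' (x * u)]) v.
      split=> //=; apply: (left_idealBr iN' (left_idealN iN' (PN' _ Pp))).
      by rewrite opprK -ez.
    rewrite -e => -[_ /= Nvu]; rewrite ez; apply: left_idealD => //.
    exact: PN.
have /choice[next nextP] := step.
have subU : [/\ left_ideal U, P `<=` U, U `<=` L & exists x, U x /\ ~ P x] by split.
pose c k := iter k next (exist _ U subU : sub).
have cS k : sval (c k.+1) `<=` sval (c k) by case: (nextP (c k)).
have cU k : sval (c k) `<=` U.
  by elim: k => [//|k IH]; exact: subset_trans (cS k) IH.
have cP k : left_ideal (sval (c k)) /\ P `<=` sval (c k) by case: (c k) => V [].
have [||n /(_ n (leqnn n)) H] := devU (fun k => sval (c k)).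
- by move=> k; have [] := cP k; split.
- by move=> k; rewrite subsetEset.
have inF N : left_ideal N -> sval (c n.+1) `<=` N -> N `<=` sval (c n) ->
    factor (between P U) (sval (c n.+1)) (sval (c n)) N.
  by move=> iN; apply: factor_between => //; case: (cP n.+1).
have [_ [x [xn xn1]] ndev] := nextP (c n).
case: H => [triv|[i devi]].
  have e : sval (c n.+1) = sval (c n).
    apply: triv; last by rewrite subsetEset.
    - by apply: inF => //; case: (cP n.+1).
    - by apply: inF => //; case: (cP n).
  by apply: xn1; rewrite -[next _]/(c n.+1) e.
apply: (ndev i); apply: (@dev_le_embed _ _ _ _ id) devi => //.
by move=> N [iN [? ?]]; exact: inF.
Qed.

(** If [U U] were inside [P], semiprimeness would put [U] inside [P]. So some [u] in [U] does not
    kill [U] modulo [P], and criticality makes multiplication by it injective. *)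
Lemma critical_self_faithful P U : ideal P -> semiprime P -> critical P U ->
  exists u, [/\ U u, ~ P u & forall x, U x -> P (x * u) -> P x].
Proof.
move=> idP spP [iU PU [y [Uy nPy]] critU].
have [u [Uu [x [Ux nxu]]]] : exists u, U u /\ exists x, U x /\ ~ P (x * u).
  apply: contrapT => H; apply: nPy; apply: spP => r; rewrite -mulrA.
  apply: contrapT => nP; apply: H; exists (r * y); split.
    exact: left_idealM.
  by exists y.
exists u; split; [by []| |by apply: critU => //; exists x].
by move=> Pu; apply: nxu; apply: left_idealM => //; exact: idP.1.
Qed.

Definition orthogonal P (a : nat -> R) n :=
  (forall i, (i < n)%N -> forall x, P (x * a i * a i) -> P (x * a i)) /\
  (forall i j, (i < j < n)%N -> P (a j * a i)).

(** Multiplying by [a 0] leaves only [r 0 * a 0 * a 0] modulo [P], whence [r 0 * a 0] is in [P];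
    drop this term and shift the sequence. *)
Lemma orthogonal_sum P a n (r : nat -> R) : ideal P -> orthogonal P a n ->
  (forall k, (k < n)%N -> P ((\sum_(j < n) r j * a j) * a k)) ->
  forall j, (j < n)%N -> P (r j * a j).
Proof.
move=> idP; have iP := idP.1; elim: n a r => [//|n IH] a r [sq ort] H.
have P0 : P (r 0%N * a 0%N).
  apply: sq => //; have := H 0%N isT; rewrite big_ord_recl mulrDl addrC => H0.
  rewrite -[X in P X](addKr (\sum_(i < n) r i.+1 * a i.+1 * a 0%N)).
  apply: left_idealD => //.
    apply: left_idealN => //; apply: left_ideal_sum => // i.
    by rewrite -mulrA; apply: left_idealM => //; apply: ort; rewrite /= ltnS.
  by rewrite mulr_suml in H0.
case=> [//|j]; rewrite ltnS => jn.
apply: (IH (a \o S) (r \o S)) => //.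
  split; first by move=> i i_n; apply: sq.
  by move=> i k ik; apply: ort.
move=> k kn; have := H k.+1 kn; rewrite big_ord_recl mulrDl => Hk.
apply: (left_idealBr iP (left_idealN iP (idealMr (a k.+1) idP P0))).
by rewrite opprK addrC.
Qed.

(** The left ideals generated by [P] and subfamilies of the [a i] would form a copy of the power set
    of [nat]. *)
Lemma no_infinite_orthogonal P a : ideal P -> has_dev P ->
  (forall n, orthogonal P a n) -> (forall i, ~ P (a i)) -> False.
Proof.
move=> idP [b devb] ort nPa; have iP := idP.1.
pose phi (A : set nat) : set R := [set x | forall L, left_ideal L -> P `<=` L ->
  (forall j, A j -> L (a j)) -> L x].
apply: (@powerset_nat_no_dev b); apply: (@dev_le_embed _ _ _ _ phi) devb.
- move=> A _; split; last by split=> // p Pp L iL PL _; exact: PL.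
  apply/left_idealP; split=> [L iL _ _|x y Ax Ay L iL PL AL|r x Ax L iL PL AL].
  + exact: left_ideal0.
  + by apply: left_idealD => //; [exact: Ax|exact: Ay].
  + by apply: left_idealM => //; exact: Ax.
- move=> A B _ _; rewrite !subsetEset => AB x Ax L iL PL BL.
  by apply: Ax => // j /AB; exact: BL.
move=> A B _ _; rewrite subsetEset => AB e; apply/seteqP; split=> // i Bi.
apply: contrapT => nAi.
have : phi B (a i) by move=> L _ _; apply.
rewrite -e => phiA.
(* [J] is a left ideal containing [P] and every [a j] with [j <> i]: for [j < i] take [a j] itself
   as the combination, for [j > i] the zero one. It omits [a i] by [orthogonal_sum]. *)
pose J : set R := [set x | exists r : nat -> R, forall k, (k < i.+1)%N ->
  P ((x - \sum_(j < i) r j * a j) * a k)].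
have [||j Aj|r rP] := phiA J.
- apply/left_idealP; split.
  + exists (fun=> 0) => k _; rewrite big1 ?subr0 ?mul0r; last first.
      by move=> j _; rewrite mul0r.
    exact: left_ideal0.
  + move=> x y [r rP] [s sP]; exists (fun j => r j + s j) => k ki.
    under eq_bigr do rewrite mulrDl.
    rewrite big_split opprD addrACA mulrDl.
    by apply: left_idealD => //; [exact: rP|exact: sP].
  + move=> s x [r rP]; exists (fun j => s * r j) => k ki.
    under eq_bigr do rewrite -mulrA.
    by rewrite -mulr_sumr -mulrBr -mulrA; apply: left_idealM => //; exact: rP.
- move=> p Pp; exists (fun=> 0) => k _; rewrite big1 ?subr0; last first.
    by move=> j _; rewrite mul0r.
  exact: idealMr.
- have [ji|ij] := ltnP j i.
    exists (fun k => (k == j)%:R) => k _.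
    rewrite (bigD1 (Ordinal ji))//= eqxx mul1r big1 ?addr0 ?subrr ?mul0r.
      exact: left_ideal0.
    by move=> l /negPf; rewrite -val_eqE /= => ->; rewrite mul0r.
  exists (fun=> 0) => k ki; rewrite big1 ?subr0; last first.
    by move=> l _; rewrite mul0r.
  apply: (ort j.+1).2; rewrite ltnSn andbT (leq_trans ki)//.
  by rewrite ltn_neqAle ij andbT; apply/eqP => eij; rewrite eij in nAi.
apply: (nPa i); rewrite -[a i]mul1r.
have := @orthogonal_sum P a i.+1 (fun j => if j == i then 1 else - r j) idP (ort _).
move=> /(_ _ i (ltnSn i)); rewrite eqxx; apply=> k ki.
rewrite big_ord_recr /= eqxx mul1r addrC.
under eq_bigr => j _ do rewrite (ltn_eqF (ltn_ord j)) mulNr.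
by rewrite sumrN; exact: rP.
Qed.

(* Goldie's argument: inside a left ideal, pick successively elements of critical
   left ideals annihilating all the previous ones; the process stops as the picked
   elements generate a direct sum. *)
Lemma critical_cover P E :
  ideal P -> semiprime P -> has_dev P -> left_ideal E -> P `<=` E ->
  exists n (a : nat -> R), [/\ orthogonal P a n,
    forall i, (i < n)%N -> E (a i) /\ exists U, critical P U /\ U (a i) &
    forall x, E x -> (forall i, (i < n)%N -> P (x * a i)) -> P x].
Proof.
move=> idP spP devP iE PE; have iP := idP.1.
pose good u := ~ P u /\ exists U,
  [/\ critical P U, U u & forall x, U x -> P (x * u) -> P x].
have /choice[next nextP] (L : set R) : exists u, left_ideal L -> P `<=` L ->
    (exists x, L x /\ ~ P x) -> L u /\ good u.
  have [[iL [PL ntL]]|nL] := pselect (left_ideal L /\ P `<=` L /\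
      exists x, L x /\ ~ P x); last by exists 0 => iL PL ntL; case: nL.
  have [U [cU UL]] := critical_exists idP devP iL PL ntL.
  have [u [Uu nPu fu]] := critical_self_faithful idP spP cU.
  by exists u => _ _ _; split; [exact: UL|split=> //; exists U].
pose L k := iter k (fun L => L `&` [set x | P (x * next L)]) E.
pose a k := next (L k).
have LP k x : L k x <-> E x /\ forall i, (i < k)%N -> P (x * a i).
  elim: k => [|k IH]; first by split=> [|[]].
  split=> [[/IH[Ex xP] xk]|[Ex xP]].
    by split=> // i; rewrite ltnS leq_eqVlt => /predU1P[->//|/xP].
  by split; [apply/IH; split=> // i ik; apply: xP; exact: ltnW|exact: xP].
have idL k : left_ideal (L k) /\ P `<=` L k.
  elim: k => [//|k [iL PL]]; split.
    by apply: left_ideal_setI => //; exact: left_ideal_colon.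
  by move=> p Pp; split; [exact: PL|exact: idealMr].
have aP k : (exists x, L k x /\ ~ P x) -> L k (a k) /\ good (a k).
  by move=> ntL; have [iL PL] := idL k; exact: nextP.
have ort n : (forall k, (k < n)%N -> exists x, L k x /\ ~ P x) -> orthogonal P a n.
  move=> nt; split=> [i /nt/aP[_ [_ [U [[iU _ _ _] Ui fi]]]] x|i j /andP[ij /nt/aP]].
    by apply: fi; exact: left_idealM.
  by move=> [/LP[_ /(_ i ij)]].
have ex : exists n, `[< L n `<=` P >].
  apply: contrapT => nex.
  have nt k : exists x, L k x /\ ~ P x.
    apply: contrapT => nx; apply: nex; exists k; apply/asboolP => x Lx.
    by apply: contrapT => nPx; apply: nx; exists x.
  apply: (@no_infinite_orthogonal P a) => // [n|i]; first exact: ort.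
  by have [_ []] := aP i (nt i).
case: (ex_minnP ex) => n /asboolP Ln minn.
have nt k : (k < n)%N -> exists x, L k x /\ ~ P x.
  move=> kn; apply: contrapT => nx.
  suff /minn : `[< L k `<=` P >] by rewrite leqNgt kn.
  apply/asboolP => x Lx.
  by apply: contrapT => nPx; apply: nx; exists x.
exists n, a; split; [exact: ort| |].
  move=> i /nt/aP[/LP[Ei _] [_ [U [cU Ui _]]]]; split=> //.
  by exists U.
by move=> x Ex xP; apply/Ln/LP.
Qed.

(** Cover [E + P] by orthogonal [a i]; their sum is [e] modulo [P] with [e] in [E]. If [x * e] is in
    [P], so is each [x * a i], and then every multiple of [x] in [E] lies in [P] by the cover,
    against essentiality unless [x] is in [P]. *)
Lemma essential_lregular P E :
  ideal P -> semiprime P -> has_dev P -> left_ideal E -> essential P E ->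
  exists c, E c /\ lregular P c.
Proof.
move=> idP spP devP iE essE; have iP := idP.1.
have [n [a [ort aE cover]]] := critical_cover idP spP devP
  (left_ideal_mulD 1 iE iP) (fun p => @mulDr E 1 P p iE).
have : mulD E 1 P (\sum_(i < n) a i).
  apply: left_ideal_sum; first exact: left_ideal_mulD.
  by move=> i; case: (aE i (ltn_ord i)).
move=> [e [p [Ee Pp]]]; rewrite mulr1 => sum_a.
exists e; split=> // x Pxe.
have xa y i : P (y * e) -> (i < n)%N -> P (y * a i).
  move=> Pye; apply: (@orthogonal_sum P a n (fun=> y) idP ort _ i) => k kn.
  rewrite -mulr_sumr sum_a; apply: idealMr => //.
  by rewrite mulrDr; apply: left_idealD => //; exact: left_idealM.
apply: contrapT => /essE[r [Erx]]; apply; apply: cover.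
  by rewrite -[_ * x]mulr1; exact: mulDl.
by move=> i; apply: xa; rewrite -mulrA; exact: left_idealM.
Qed.

(** Otherwise [R y + P] contains a critical [U] and a self-faithful [u = r * y + p] in it. If
    [s * u * r * y] is in [P], so is [s * u * u], hence [s * u]; thus the annihilator of [y] meets
    [R u r] only inside [P]. *)
Lemma essential_nonsingular P y :
  ideal P -> semiprime P -> has_dev P -> essential P [set x | P (x * y)] -> P y.
Proof.
move=> idP spP devP essy; have iP := idP.1; apply: contrapT => nPy.
have [|U [cU Uy]] := critical_exists idP devP
  (left_ideal_mulD y left_ideal_setT iP) (fun p => @mulDr _ y P p left_ideal_setT).
  by exists y; split=> //; rewrite -[y in mulD _ _ _ y]mul1r; exact: mulDl.
have [u [Uu nPu fu]] := critical_self_faithful idP spP cU.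
have [iU _ _ _] := cU.
have [r [p [_ Pp eu]]] := Uy _ Uu.
have step s : P (s * u * r * y) -> P (s * u).
  move=> Psy; apply: fu; first exact: left_idealM.
  rewrite {2}eu mulrDr mulrA; apply: left_idealD => //; exact: left_idealM.
have nur : ~ P (u * r).
  by move=> Pur; apply: nPu; rewrite -[u]mul1r; apply: step;
    rewrite mul1r; exact: idealMr.
have [s [Ps nPs]] := essy _ nur.
by apply: nPs; rewrite mulrA; apply: idealMr => //; apply: step; rewrite -(mulrA s).
Qed.

(** * Prime ideals and the drop of deviation *)

Definition prime P := [/\ ideal P, ~ P 1 &
  forall x y, (forall r, P (x * r * y)) -> P x \/ P y].

Lemma prime_mul P x y : prime P -> ~ P x -> ~ P y -> exists r, ~ P (x * r * y).
Proof.
move=> [_ _ prP] nPx nPy; apply: contrapT => nr.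
by case: (prP x y) => // r; apply: contrapT => nP; apply: nr; exists r.
Qed.

Lemma prime_semiprime P : prime P -> semiprime P.
Proof. by move=> [_ _ prP] x /prP[]. Qed.

(* For [d] in [Q] regular modulo [P], every factor of the chain [R d^n + P] is
   isomorphic to [R / (R d + P)], of which [R / Q] is a quotient. *)
Lemma prime_proper_dev P Q A f : prime P -> ideal Q -> ~ Q 1 ->
  P `<=` Q -> Q <> P -> dev_le (Olub A f) (between P setT) ->
  exists i, dev_le (f i) (between Q setT).
Proof.
move=> primeP idQ Q1 PQ QP devP; have [idP _ _] := primeP; have iP := idP.1.
have [y [Qy nPy]] : exists y, Q y /\ ~ P y.
  apply: contrapT => ny; apply: QP; apply/seteqP; split=> // y Qy.
  by apply: contrapT => nPy; apply: ny; exists y.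
have essQ : essential P Q.
  move=> x nPx; apply: contrapT => nr.
  have [r nP] := prime_mul primeP nPy nPx.
  by apply: nr; exists (y * r); split=> //; do 2!apply: idealMr => //.
have hasP : has_dev P by exists (Olub A f).
have [d [Qd reg_d]] :=
  essential_lregular idP (prime_semiprime primeP) hasP idQ.1 essQ.
have reg k : lregular P (d ^+ k).
  elim: k => [|k IH] x; first by rewrite expr0 mulr1.
  by rewrite exprS mulrA => /IH/reg_d.
have iD N k : left_ideal N -> left_ideal (mulD N (d ^+ k) P).
  by move=> iN; exact: left_ideal_mulD.
have [k|k|n /(_ n (leqnn n)) H] := devP (fun k => mulD setT (d ^+ k) P).
- split; first exact/iD/left_ideal_setT.
  by split=> // p; apply: mulDr; exact: left_ideal_setT.
- rewrite subsetEset => _ [l [p [_ Pp ->]]]; exists (l * d), p; split=> //.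
  by rewrite exprS mulrA.
(* [N |-> N d^n + P] lands in the [n]-th factor because [d] is in [Q], hence in [N]. *)
have inF N : left_ideal N -> Q `<=` N -> factor (between P setT)
    (mulD setT (d ^+ n.+1) P) (mulD setT (d ^+ n) P) (mulD N (d ^+ n) P).
  move=> iN QN; apply: factor_between => //.
  - exact: iD.
  - by move=> p; apply: mulDr; exact: left_ideal_setT.
  - move=> _ [l [p [_ Pp ->]]]; exists (l * d), p; split=> //.
      by apply: left_idealM => //; exact: QN.
    by rewrite exprS mulrA.
  - exact: mulDS.
have inj N N' : left_ideal N -> Q `<=` N -> N `<=` N' ->
    mulD N (d ^+ n) P = mulD N' (d ^+ n) P -> N = N'.
  move=> iN QN NN e; apply/seteqP; split=> // x N'x.
  apply: (mulD_lregular iN (subset_trans PQ QN) (reg n)).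
  by rewrite e; exact: mulDl.
case: H => [triv|[i devi]].
  have e : Q = setT.
    apply: inj => //; first exact: idQ.1.
    apply: triv; [apply: inF => //; exact: idQ.1| |].
      by apply: inF => //; exact: left_ideal_setT.
    by rewrite subsetEset; exact: mulDS.
  by case: Q1; rewrite e.
exists i; apply: (@dev_le_embed _ _ _ _ (fun N => mulD N (d ^+ n) P)) devi.
- by move=> N [iN [QN _]]; exact: inF.
- by move=> N N' _ _; rewrite !subsetEset; exact: mulDS.
- by move=> N N' [iN [QN _]] _; rewrite subsetEset; exact: inj.
Qed.

(** * Semiprime rings and annihilator primes *)

(** If [x R x = 0], the ideal [J] generated by [x] has square zero: the elements killing on one side
    form an ideal, so [x] is replaced by [J] one factor at a time. *)
Lemma semiprime_ringP : semiprime_ring R -> semiprime [set 0].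
Proof.
move=> spR x xRx /=.
pose J : set R := [set z | forall I, ideal I -> I x -> I z].
have idJ : ideal J.
  split.
    apply/left_idealP; split=> [I [iI _] _|y z Jy Jz I idI Ix|r z Jz I idI Ix].
    - exact: left_ideal0.
    - by apply: left_idealD; [exact: idI.1|exact: Jy|exact: Jz].
    - by apply: left_idealM; [exact: idI.1|exact: Jz].
  by move=> z r Jz I idI Ix; apply: idealMr => //; exact: Jz.
have Jx z : J z -> forall s, z * s * x = 0.
  move=> /(_ [set z | forall s, z * s * x = 0]); apply; last exact: xRx.
  split; last by move=> y r /= H s; rewrite -(mulrA y).
  apply/left_idealP; split=> [s|y w /= Hy Hw s|r y /= Hy s].
  - by rewrite !mul0r.
  - by rewrite !mulrDl Hy Hw addr0.
  - by rewrite -!mulrA (mulrA y) Hy mulr0.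
have JJ z w : J z -> J w -> z * w = 0.
  move=> Jz /(_ [set w | forall s, z * s * w = 0]) H.
  rewrite -[z]mulr1; apply: H => //; last exact: Jx.
  split; last by move=> y r /= Hy s; rewrite mulrA Hy mul0r.
  apply/left_idealP; split=> [s|y v /= Hy Hv s|r y /= Hy s].
  - by rewrite mulr0.
  - by rewrite mulrDr Hy Hv addr0.
  - by rewrite mulrA -(mulrA z) Hy.
have J0 : J = [set 0].
  apply: spR => //; exists 2 => y Jy.
  by rewrite !big_ord_recl big_ord0 mulr1; exact: JJ.
have : J x by [].
by rewrite J0.
Qed.

Lemma ideal0 : ideal [set (0 : R)].
Proof.
split; last by move=> x r /= ->; rewrite mul0r.
apply/left_idealP; split=> //= [y z -> ->|r y ->]; first by rewrite addr0.
by rewrite mulr0.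
Qed.

Lemma essential_left_idealP E : essential_left_ideal E -> essential [set 0] E.
Proof.
move=> [iE essE] x nx.
have i0 := ideal0.1; have iRx := left_ideal_mulD x left_ideal_setT i0.
apply: contrapT => nr; apply: (essE _ iRx).
  move=> e; apply: nx; rewrite -e -[x in mulD _ _ _ x]mul1r.
  exact: mulDl.
apply/seteqP; split=> [z [Ez [r [p [_ -> ez]]]]|z /= ->]; last first.
  by split; exact: left_ideal0.
rewrite addr0 in ez; apply: contrapT => nz; apply: nr; exists r.
by rewrite -ez.
Qed.

Definition ann U : set R := [set x | forall u, U u -> x * u = 0].

(* For semiprime [R] with Krull dimension, these are the minimal primes. *)
Definition annihilator_prime P := prime P /\ exists U, left_ideal U /\ P = ann U.

(** If [a R b] kills [U] but [b] does not, a nonzero [v] in [U] has [a R v = 0], so [v R a = 0] by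
    semiprimeness. Multiplication by [s * (a * u)] kills [v], hence by criticality all of [U],
    including [a * u]; semiprimeness gives [a * u = 0]. *)
Lemma ann_critical_prime U : semiprime [set 0] -> critical [set 0] U ->
  annihilator_prime (ann U).
Proof.
move=> spR [iU _ [u0 [Uu0 nu0]] critU]; split; last by exists U.
split.
- split; last first.
    by move=> x r Px u Uu; rewrite -mulrA; apply: Px; exact: left_idealM.
  apply/left_idealP; split=> [u _|x y Px Py u Uu|r x Px u Uu].
  + by rewrite mul0r.
  + by rewrite mulrDl Px ?Py ?addr0.
  + by rewrite -mulrA Px ?mulr0.
- by move=> /(_ u0 Uu0); rewrite mul1r.
move=> a b H; apply: contrapT => /not_orP[nPa nPb].
have [v [Uv [nv av]]] : exists v, U v /\ v <> 0 /\ forall r, a * r * v = 0.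
  apply: contrapT => nv; apply: nPb => u Uu; apply: contrapT => nbu; apply: nv.
  exists (b * u); split; [exact: left_idealM|split=> // r].
  by rewrite mulrA; exact: H.
have va s : v * s * a = 0.
  apply: spR => r /=.
  rewrite (_ : _ * _ = v * s * (a * r * v) * (s * a)); last by rewrite !mulrA.
  by rewrite av mulr0 mul0r.
apply: nPa => u Uu; apply: spR => s /=; apply: contrapT => ne.
apply: nv; apply: (critU (s * (a * u))) => //.
- by do 2!apply: left_idealM => //.
- exists (a * u); split; first exact: left_idealM.
  by rewrite mulrA.
- by rewrite /= !mulrA va mul0r.
Qed.

Lemma annihilator_prime_self U : semiprime [set 0] -> left_ideal U ->
  ~ ann U 1 -> exists u, U u /\ ~ ann U u.
Proof.
move=> spR iU n1; apply: contrapT => nu; apply: n1 => u Uu; rewrite mul1r.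
apply: spR => r /=; rewrite -mulrA; apply: contrapT => ne; apply: nu.
exists u; split=> // /(_ (r * u)) H; apply: ne; apply: H.
exact: left_idealM.
Qed.

(** Write [Q = ann U] and take [u] in [U] outside [Q]: then [Q R u = 0] while [u] is not in [P], so
    [Q] is inside [P]. *)
Lemma annihilator_prime_minimal P Q : semiprime [set 0] ->
  annihilator_prime P -> annihilator_prime Q -> P `<=` Q -> P = Q.
Proof.
move=> spR [[idP _ prP] _] [[_ Q1 _] [U [iU eQ]]] PQ; subst Q.
apply/seteqP; split=> // x Qx.
have [u [Uu nu]] := annihilator_prime_self spR iU Q1.
have [r|//|/PQ//] := prP x u.
rewrite -mulrA (_ : x * (r * u) = 0); first exact: left_ideal0 idP.1.
by apply: Qx; exact: left_idealM.
Qed.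

(** For [P = ann U], multiply [x] into a nonzero element of [U R], then into [E]. By semiprimeness a
    nonzero element of [U R] is not in [ann U]. *)
Lemma annihilator_prime_essential P E : semiprime [set 0] ->
  annihilator_prime P -> essential [set 0] E -> essential P E.
Proof.
move=> spR [primeP [U [iU eP]]] essE x nPx; subst P.
have [idP P1 _] := primeP.
have [u [Uu nu]] := annihilator_prime_self spR iU P1.
have [r nr] := prime_mul primeP nu nPx.
have [|s [Es ns]] := essE (u * r * x).
  by move=> /= e; apply: nr; rewrite e; exact: left_ideal0 idP.1.
exists (s * (u * r)); rewrite -(mulrA s); split=> // Us; apply: ns.
apply: spR => t /=.
have e := idealMr (t * s) idP Us u Uu.
rewrite (_ : _ * _ = s * (u * r * x) * (t * s) * u * (r * x)); last by rewrite !mulrA.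
by rewrite e mul0r.
Qed.

Lemma annihilator_primes_meet : semiprime [set 0] -> has_dev [set 0] ->
  exists n (P : 'I_n -> set R), (forall i, annihilator_prime (P i)) /\
    forall x, (forall i, P i x) -> x = 0.
Proof.
move=> spR devR.
have [|n [a [_ aU cover]]] :=
  critical_cover (E := setT) ideal0 spR devR left_ideal_setT => //.
have /choice[U UP] (i : 'I_n) : exists U, critical [set 0] U /\ U (a i).
  by case: (aU i (ltn_ord i)).
exists n, (fun i => ann (U i)); split=> [i|x xP].
  by apply: ann_critical_prime; case: (UP i).
apply: cover => // i i_n; have := xP (Ordinal i_n); apply.
by case: (UP (Ordinal i_n)).
Qed.

(** If no [P i] were inside [Q], products [y * r * z] would build, one index at a time, an element
    of all the [P i] outside [Q]. *)
Lemma prime_meet n (P : 'I_n -> set R) Q : (forall i, ideal (P i)) -> prime Q ->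
  (forall x, (forall i, P i x) -> Q x) -> exists i, P i `<=` Q.
Proof.
move=> idP primeQ PQ; have [_ Q1 _] := primeQ; apply: contrapT => nP.
suff /(_ n) [y [nQy yP]] m : exists y, ~ Q y /\ forall i : 'I_n, (i < m)%N -> P i y.
  by apply: nQy; apply: PQ => i; exact: yP.
elim: m => [|m [y [nQy yP]]]; first by exists 1.
have [mn|nm] := ltnP m n; last first.
  by exists y; split=> // i _; apply: yP; exact: leq_trans nm.
have [z [Pz nQz]] : exists z, P (Ordinal mn) z /\ ~ Q z.
  apply: contrapT => nz; apply: nP; exists (Ordinal mn) => z Pz.
  by apply: contrapT => nQz; apply: nz; exists z.
have [r nQ] := prime_mul primeQ nQy nQz.
exists (y * r * z); split=> // i; rewrite ltnS leq_eqVlt => /predU1P[im|im].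
  rewrite (_ : i = Ordinal mn); last exact/val_inj.
  by apply: left_idealM => //; exact: (idP _).1.
by do 2!apply: idealMr => //; exact: yP.
Qed.

(** * Preimages of primes under an endomorphism with large image *)

Section LargeImage.
Variables (sigma : {rmorphism R -> R}) (E : set R).
Hypotheses (iE : left_ideal E) (Esub : E `<=` range sigma).

Let preim P : set R := [set x | P (sigma x)].

Lemma left_ideal_preim L : left_ideal L -> left_ideal (preim L).
Proof.
move=> iL; apply/left_idealP; split=> [|x y Lx Ly|r x Lx]; rewrite /preim /=.
- by rewrite rmorph0; exact: left_ideal0.
- by rewrite rmorphD; exact: left_idealD.
- by rewrite rmorphM; exact: left_idealM.
Qed.

Lemma ideal_preim P : ideal P -> ideal (preim P).
Proof.
move=> idP; split; first exact: left_ideal_preim idP.1.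
by move=> x r Px; rewrite /preim /= rmorphM; exact: idealMr.
Qed.

(** If [a R b] is in the preimage and [a] is not, then [y * sigma b] is in [P] for all [y] in [E],
    because [R y] lies in the image. Nonsingularity then puts [sigma b] in [P]. *)
Lemma prime_preim P : prime P -> has_dev P -> essential P E -> prime (preim P).
Proof.
move=> primeP devP essE; have [idP P1 prP] := primeP.
split; [exact: ideal_preim|by rewrite /preim /= rmorph1|].
move=> a b H; apply: contrapT => /not_orP[nPa nPb]; apply: nPb.
apply: (essential_nonsingular idP (prime_semiprime primeP) devP) => x.
move=> /essE[r [Erx nPrx]]; exists r; split=> //=.
have [s|//|//] := prP (sigma a) (r * x * sigma b).
have [t _ et] : range sigma (s * (r * x)) by apply: Esub; exact: left_idealM.
by rewrite -mulrA (mulrA s) -et mulrA -!rmorphM; exact: H.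
Qed.

(** Take [r] in [E] outside [Q]. For [x] in [P], the products [x * s * r] lie in [P] and in the
    image, hence in [Q]; so [x] is in [Q]. *)
Lemma preim_sub P Q : prime Q -> left_ideal P -> ideal P -> essential Q E ->
  preim P `<=` preim Q -> P `<=` Q.
Proof.
move=> [idQ Q1 prQ] iP idP /(_ _ Q1)[r]; rewrite mulr1 => -[Er nQr] PQ x Px.
have [s|//|//] := prQ x r.
have [t _ et] : range sigma (x * s * r) by apply: Esub; exact: left_idealM.
by rewrite -et; apply: PQ; rewrite /preim /= et; do 2!apply: idealMr => //.
Qed.

(* [L |-> sigma^-1 (L c + P)] embeds the left ideals above [P] into those above
   [sigma^-1 P], for [c] in [E] regular modulo [P]: it is injective because
   [L c] lies in the image of [sigma]. *)
Lemma dev_le_preim P a : prime P -> has_dev P -> essential P E ->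
  dev_le a (between (preim P) setT) -> dev_le a (between P setT).
Proof.
move=> primeP devP essE; have [idP _ _] := primeP; have iP := idP.1.
have [c [Ec reg_c]] :=
  essential_lregular idP (prime_semiprime primeP) devP iE essE.
apply: (@dev_le_embed _ _ _ _ (fun L => preim (mulD L c P))).
- move=> L [iL _]; split; first by apply: left_ideal_preim; exact: left_ideal_mulD.
  by split=> // x Px; exact: (@mulDr L c P (sigma x)).
- by move=> L N _ _; rewrite !subsetEset => LN x; exact: mulDS.
move=> L N [iL [PL _]] _; rewrite subsetEset => LN e.
apply/seteqP; split=> // x Nx; apply: (mulD_lregular iL PL reg_c).
have [t _ et] : range sigma (x * c) by apply: Esub; exact: left_idealM.
rewrite -et; suff : preim (mulD L c P) t by [].
by rewrite e /preim /= et; exact: mulDl.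
Qed.

End LargeImage.
End LeftIdeals.

(** * Periodic indices and injectivity of [sigma] *)

Lemma iter_cyclic n (t : 'I_n -> 'I_n) i :
  exists m k, iter k.+1 t (iter m t i) = iter m t i.
Proof.
have /injectivePn[x [y nxy exy]] :
    ~~ injectiveb (fun m : 'I_n.+1 => iter m t i).
  by apply/injectiveP => /leq_card; rewrite !card_ord ltnn.
wlog xy : x y nxy exy / (x < y)%N.
  move=> W; have [xy|yx|/val_inj exy'] := ltngtP x y; first exact: (W x y).
    by apply: (W y x) => //; rewrite eq_sym.
  by rewrite exy' eqxx in nxy.
exists x, (y - x).-1; rewrite -iterD prednK ?subn_gt0// subnK//.
exact: ltnW.
Qed.

Theorem theorem1p2 (R : pzRingType) (sigma : {rmorphism R -> R}) :
  semiprime_ring R ->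
  has_Krull_dim R^o ->
  large_image sigma ->
  injective sigma.
Proof.
move=> /semiprime_ringP spR /deviation_exP[a0 devR0] [E [essE Esub]].
have iE := essE.1; have {}essE := essential_left_idealP essE.
have devR (P : set R) : has_dev P.
  exists a0; apply: (@dev_le_embed _ _ _ _ id) devR0 => // N [iN _].
  exact: iN.
have [n [P [annP meetP]]] := annihilator_primes_meet spR (devR _).
have primeP i : prime (P i) by case: (annP i).
have idP i : ideal (P i) by case: (primeP i).
have essP i : essential (P i) E by exact: annihilator_prime_essential.
pose P' i : set R := [set x | P i (sigma x)].
have primeP' i : prime (P' i) by exact: (prime_preim iE Esub).
have sub_eq i j : P' i `<=` P' j -> P i = P j.
  move=> /(preim_sub iE Esub (primeP j) (idP i).1 (idP i) (essP j)).
  exact: annihilator_prime_minimal.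
have /choice[t tP] i : exists j, P j `<=` P' i.
  apply: prime_meet => // x /meetP ->; rewrite /P' /= rmorph0.
  exact: left_ideal0 (idP i).1.
have dev_t i a : dev_le a (between (P (t i)) setT) -> dev_le a (between (P i) setT).
  move=> devt; apply: (dev_le_preim iE Esub) => //.
  exact: dev_le_betweenS devt.
have dev_iter m i a :
    dev_le a (between (P (iter m t i)) setT) -> dev_le a (between (P i) setT).
  by elim: m => [//|m IH] /dev_t.
have cyclic_eq i m : iter m.+1 t i = i -> P' i = P (t i).
  move=> cyc; apply: contrapT => ne; have [a0' deva0] := devR (P i).
  (* Take the least bound for [R / P i]. The remaining [m] steps of the cycle carry it to [P (t i)];
     a strict inclusion in [P' i] would lower it for [P' i], hence for [P i]. *)
  have [[A f] [_ [deva mina]]] :=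
    @dev_le_min _ _ unit (fun=> between (P i) setT) tt _ deva0.
  have : dev_le (Olub A f) (between (P (t i)) setT).
    by apply: (dev_iter m); rewrite -iterSr cyc.
  have [idP' P'1 _] := primeP' i.
  move=> /(prime_proper_dev (primeP _) idP' P'1 (@tP i) ne)[k devk].
  apply: (mina (f k) tt (ordi_lt_Olub f k)).
  exact: (dev_le_preim iE Esub).
(* If [P (t i) = P j] with [j] periodic, the predecessor [j'] of [j] on its cycle has [P' j' = P j],
   which is inside [P' i]; so [P j' = P i]. *)
have reach i m k : iter k.+1 t (iter m t i) = iter m t i ->
    exists j l, P i = P j /\ iter l.+1 t j = j.
  elim: m i => [|m IH] i; first by exists i, k.
  rewrite [iter m.+1 t i]iterSr => /IH[j [l [ej cyc]]].
  exists (iter l t j), l; split; last by rewrite -iterD addnC iterD cyc.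
  apply/esym/sub_eq; rewrite (@cyclic_eq _ l); last first.
    by rewrite -iterD addnC iterD cyc.
  by rewrite -iterS cyc -ej; exact: tP.
have P_P' i : exists j, P i = P' j.
  have [m [k /reach[j [l [-> cyc]]]]] := iter_cyclic t i.
  exists (iter l t j); rewrite (@cyclic_eq _ l) -?iterS ?cyc//.
  by rewrite -iterD addnC iterD cyc.
move=> x y exy; apply/eqP; rewrite -subr_eq0; apply/eqP/meetP => i.
have [j ->] := P_P' i; rewrite /P' /= rmorphB exy subrr.
exact: left_ideal0 (idP j).1.
Qed.
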